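(* Let $h:\mathbb{N}\to(0,\infty)$ be a growth function and $(H_0,H_1)=(\ell^2,\ell^2_h)$. Let $\mathfrak{a},\mathfrak{b}\in\mathfrak{G}_1$ be shift-invariant growth types. If $A$ is a weak Hessian in $(\mathcal{F}_h^{\mathfrak{a}\mathfrak{b}})^*$, then for every $\lambda\in\mathbb{R}\setminus\operatorname{spec}A$ the shifted operator $\mathbb{A}_\lambda:=A-\lambda\iota$ also lies in $(\mathcal{F}_h^{\mathfrak{a}\mathfrak{b}})^*$.
   Context: $\mathbb{N}=\{1,2,\dots\}$. A growth function is a monotone (nondecreasing) unbounded function $f:\mathbb{N}\to(0,\infty)$. Two growth functions $f,g$ have the same growth type, $f\sim g$, if there is $c>0$ with $\frac1c g(\nu)\le f(\nu)\le c\,g(\nu)$ for all $\nu$. The equivalence classes $[f]$ are called growth types; $\mathfrak{G}$ is the set of growth types. The shift of $f$ is $f_1(\nu):=f(\nu+1)$; a growth type $[f]$ is shift-invariant if $f\sim f_1$; $\mathfrak{G}_1\subset\mathfrak{G}$ is the set of shift-invariant growth types. For $r\in\mathbb{R}$, $H_r:=\ell^2_{h^r}$ is the Hilbert space of real sequences $x=(x_\nu)_{\nu\in\mathbb{N}}$ with $\sum_\nu h(\nu)^r x_\nu^2<\infty$, with inner product $\langle x,y\rangle_r=\sum_\nu h(\nu)^r x_\nu y_\nu$; for $s<r$ the inclusion $H_r\subset H_s$ is compact and dense. $\iota$ denotes the inclusion $H_1\hookrightarrow H_0$. The space of weak Hessians $\mathcal{H}_h\subset\mathcal{L}(H_1,H_0)\cap\mathcal{L}(H_2,H_1)$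 consists of all bounded linear maps $A:H_1\to H_0$ which are Fredholm of index zero, $H_0$-symmetric ($\langle Ax,y\rangle_0=\langle x,Ay\rangle_0$ for all $x,y\in H_1$), and which restrict to a bounded linear map $H_2\to H_1$ that is also Fredholm of index zero. The spectrum $\operatorname{spec}A$ (the set of real $\lambda$ for which $A-\lambda\iota$ is not an isomorphism) of $A\in\mathcal{H}_h$ consists of discrete real eigenvalues of finite multiplicity. $\mathcal{F}_h\subset\mathcal{H}_h$ denotes the subset of Floer type weak Hessians (infinitely many positive and infinitely many negative eigenvalues), and $\mathcal{F}_h^*\subset\mathcal{F}_h$ the subset of invertible ones. For $A\in\mathcal{F}_h^*$, the positive growth function $f_A^+:\mathbb{N}\to(0,\infty)$ lists the positive eigenvalues of $A$ with multiplicities in increasing order; the negative growth function $f_A^-$ lists in the same way the absolute values of the negative eigenvalues. For $\mathfrak{a},\mathfrak{b}\in\mathfrak{G}$, $$(\mathcal{F}_h^{\mathfrak{a}\mathfrak{b}})^*:=\{A\in\mathcal{F}_h^*\mid [f_A^-]=\mathfrak{a},\ [f_A^+]=\mathfrak{b}\}.$$ *)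

(* Defs.v *)
From HB Require Import structures.
From mathcomp Require Import all_boot all_order all_algebra.
From mathcomp Require Import all_classical all_reals all_analysis.
From mathcomp Require Import ring lra.
Set Implicit Arguments.
Unset Strict Implicit.
Unset Printing Implicit Defensive.
Import Order.TTheory GRing.Theory Num.Theory.
Import numFieldNormedType.Exports.
Local Open Scope classical_set_scope.
Local Open Scope card_scope.
Local Open Scope ring_scope.

(* Sequences indexed by {1, 2, 3, ...} are represented by functions on [nat]:  *)
(* the value at [n] stands for the term of index [n.+1].                       *)

Section GrowthTypes.
Context {R : realType}.
Implicit Types f g : nat -> R.

Definition growth_function f : Prop :=
  [/\ forall n, 0 < f n,
      {homo f : m n / (m <= n)%N >-> m <= n}
    & forall M : R, exists n, M < f n].

Definition same_growth f g : Prop :=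
  exists2 c : R, 0 < c & forall n, c^-1 * g n <= f n /\ f n <= c * g n.

Definition growth_class f : set (nat -> R) :=
  [set g | growth_function g /\ same_growth f g].

Definition shift_growth f : nat -> R := fun n => f n.+1.

Definition growth_types : set (set (nat -> R)) :=
  [set growth_class f | f in growth_function].

Definition shift_invariant_growth_types : set (set (nat -> R)) :=
  [set growth_class f | f in
     [set f | growth_function f /\ same_growth f (shift_growth f)]].

End GrowthTypes.

Record growthFun (R : realType) := GrowthFun {
  growth_fun :> nat -> R;
  growth_funP : growth_function growth_fun }.

Section WeightedEll2.
Context {R : realType} (h : growthFun R) (r : R).

Definition wprod (x y : nat -> R) : nat -> R :=
  fun n => h n `^ r * x n * y n.

Definition well2 : {pred nat -> R} :=
  [pred x : nat -> R | `[< cvgn (series (wprod x x)) >]].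

Lemma well2P (x : nat -> R) : reflect (cvgn (series (wprod x x))) (x \in well2).
Proof. exact: asboolP. Qed.

Lemma growth_gt0 n : 0 < h n.
Proof. by case: (growth_funP h). Qed.

Lemma weight_gt0 n : 0 < h n `^ r.
Proof. exact/powR_gt0/growth_gt0. Qed.

Lemma wprod_ge0 x n : 0 <= wprod x x n.
Proof.
by rewrite /wprod -mulrA -expr2 mulr_ge0 ?sqr_ge0// ltW ?weight_gt0.
Qed.

Lemma well2_submod : submod_closed well2.
Proof.
split.
  apply/well2P.
  have -> : wprod 0 0 = 0 by apply/funext => n; rewrite /wprod mulr0.
  rewrite (_ : series 0 = cst 0); first exact: is_cvg_cst.
  by apply/funext => n; rewrite /series/= big1.
move=> a x y /well2P cx /well2P cy; apply/well2P.
apply: (@series_le_cvg _ _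
  ((2 * a ^+ 2) *: wprod x x + 2 *: wprod y y)).
- exact: wprod_ge0.
- by move=> n; rewrite addr_ge0// mulr_ge0 ?wprod_ge0// mulr_ge0 ?sqr_ge0.
- move=> n; rewrite -subr_ge0.
  have -> : ((2 * a ^+ 2) *: wprod x x + 2 *: wprod y y) n
      - wprod (a *: x + y) (a *: x + y) n
      = h n `^ r * (a * x n - y n) ^+ 2.
    rewrite /wprod; change ((2 * a ^+ 2) * (h n `^ r * x n * x n)
      + 2 * (h n `^ r * y n * y n)
      - h n `^ r * (a * x n + y n) * (a * x n + y n)
      = h n `^ r * (a * x n - y n) ^+ 2).
    by ring.
  by rewrite mulr_ge0 ?sqr_ge0// ltW ?weight_gt0.
- by apply: is_cvg_seriesD; apply: is_cvg_seriesZ.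
Qed.

HB.instance Definition _ := GRing.isSubmodClosed.Build R (nat -> R) well2
  well2_submod.

(* The space H_r of the sequences x such that the series of h^r x^2 converges. *)
Record Hsp := HSp { hseq :> nat -> R; hseqP : hseq \in well2 }.

HB.instance Definition _ := [isSub for hseq].
HB.instance Definition _ := [Choice of Hsp by <:].
HB.instance Definition _ := [SubChoice_isSubLmodule of Hsp by <:].

Definition inner (x y : Hsp) : R := limn (series (wprod x y)).

Lemma HspE (a : R) (x y : Hsp) n : (a *: x + y) n = a * x n + y n.
Proof. by []. Qed.

Lemma wprodDl (a : R) (x y z : Hsp) :
  wprod (a *: x + y) z = a *: wprod x z + wprod y z.
Proof.
apply/funext => n; rewrite /wprod HspE.
change (h n `^ r * (a * x n + y n) * z n
  = a * (h n `^ r * x n * z n) + h n `^ r * y n * z n).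
by ring.
Qed.

Lemma wprodC (x y : nat -> R) : wprod x y = wprod y x.
Proof. by apply/funext => n; rewrite /wprod mulrAC. Qed.

Lemma is_cvg_inner (x y : Hsp) : cvgn (series (wprod x y)).
Proof.
have -> : wprod x y
    = 2^-1 *: (wprod (1 *: x + y) (1 *: x + y) - (wprod x x + wprod y y)).
  apply/funext => n; rewrite /wprod.
  change (h n `^ r * x n * y n
    = 2^-1 * (h n `^ r * (1 * x n + y n) * (1 * x n + y n)
              - (h n `^ r * x n * x n + h n `^ r * y n * y n))).
  by field.
apply: is_cvg_seriesZ; apply: is_cvg_seriesB; first exact/well2P/hseqP.
by apply: is_cvg_seriesD; apply/well2P/hseqP.
Qed.

Lemma innerC (x y : Hsp) : inner x y = inner y x.
Proof. by rewrite /inner wprodC. Qed.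

Lemma innerDl (a : R) (x y z : Hsp) :
  inner (a *: x + y) z = a * inner x z + inner y z.
Proof.
rewrite /inner wprodDl lim_seriesD; first by
    rewrite lim_seriesZ//; exact: is_cvg_inner.
  by apply: is_cvg_seriesZ; exact: is_cvg_inner.
exact: is_cvg_inner.
Qed.

Lemma inner_ge (x : Hsp) n : wprod x x n <= inner x x.
Proof.
have nd : {homo series (wprod x x) : m n / (m <= n)%N >-> m <= n}.
  by apply: nondecreasing_series => k _ _; exact: wprod_ge0.
apply: (@le_trans _ _ (series (wprod x x) n.+1)).
  rewrite seriesSr lerDr sumr_ge0// => k _; exact: wprod_ge0.
exact: (nondecreasing_cvgn_le nd (@is_cvg_inner x x) n.+1).
Qed.

Lemma inner_ge0 (x : Hsp) : 0 <= inner x x.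
Proof. exact: le_trans (wprod_ge0 x 0) (inner_ge x 0). Qed.

Lemma inner_eq0 (x : Hsp) : inner x x = 0 -> x = 0.
Proof.
move=> x0; apply/val_inj/funext => n /=; apply/eqP; rewrite -sqrf_eq0.
have := inner_ge x n; rewrite x0 => xn0.
have /eqP : wprod x x n = 0 by apply/le_anti; rewrite xn0 wprod_ge0.
by rewrite /wprod -mulrA mulf_eq0 gt_eqF ?weight_gt0//= -expr2.
Qed.

Lemma inner_sqrD (a : R) (x y : Hsp) :
  inner (a *: x + y) (a *: x + y)
    = a ^+ 2 * inner x x + 2 * a * inner x y + inner y y.
Proof.
rewrite innerDl (innerC x) (innerC y (_ + _)) !innerDl (innerC y x).
by ring.
Qed.

Lemma inner_CS (x y : Hsp) : inner x y ^+ 2 <= inner x x * inner y y.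
Proof.
have [x0|x0] := eqVneq (inner x x) 0.
  move/inner_eq0 : x0 => ->.
  have i0 z : inner 0 z = 0.
    by have := innerDl 1 0 0 z; rewrite scaler0 addr0 => H; lra.
  by rewrite !i0 mul0r expr0n.
have xp : 0 < inner x x by rewrite lt_def x0 inner_ge0.
rewrite -subr_ge0.
have := inner_ge0 ((- (inner x y / inner x x)) *: x + y).
rewrite inner_sqrD => /(mulr_ge0 (ltW xp)); congr (0 <= _).
by field.
Qed.

Definition hnorm (x : Hsp) : R := Num.sqrt (inner x x).

Lemma ler_hnormD (x y : Hsp) : hnorm (x + y) <= hnorm x + hnorm y.
Proof.
rewrite -(@ler_pXn2r _ 2)// ?nnegrE ?addr_ge0 ?sqrtr_ge0//.
rewrite sqrrD !sqr_sqrtr ?inner_ge0// -{1 2}[x]scale1r inner_sqrD.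
rewrite expr1n mul1r mulr1 lerD2r lerD2l mulr_natl ler_wMn2r//.
rewrite (le_trans (ler_norm _))// -sqrtr_sqr /hnorm -sqrtrM ?inner_ge0//.
by rewrite ler_wsqrtr// inner_CS.
Qed.

Lemma hnormZ (a : R) (x : Hsp) : hnorm (a *: x) = `|a| * hnorm x.
Proof.
rewrite /hnorm -sqrtr_sqr -sqrtrM ?sqr_ge0//; congr Num.sqrt.
have i0 z : inner 0 z = 0.
  by have := innerDl 1 0 0 z; rewrite scaler0 addr0 => H; lra.
by have := inner_sqrD a x 0; rewrite addr0 i0 innerC i0 mulr0 !addr0.
Qed.

Lemma hnorm_eq0 (x : Hsp) : hnorm x = 0 -> x = 0.
Proof.
move=> /eqP; rewrite sqrtr_eq0 => x0; apply/inner_eq0/le_anti.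
by rewrite x0 inner_ge0.
Qed.

HB.instance Definition _ := @Lmodule_isNormed.Build R Hsp hnorm
  ler_hnormD hnormZ hnorm_eq0.

End WeightedEll2.

Section Inclusion.
Context {R : realType} (h : growthFun R) (s r : R) (sr : s <= r).

Lemma well2_sub : {subset well2 h r <= well2 h s}.
Proof.
move=> x /well2P cx; apply/well2P.
apply: (@series_le_cvg _ _ (h 0 `^ (s - r) *: wprod h r x x)).
- exact: wprod_ge0.
- by move=> n; rewrite mulr_ge0 ?wprod_ge0// powR_ge0.
- move=> n.
  have hh : h n `^ s <= h 0 `^ (s - r) * h n `^ r.
    have -> : h n `^ s = h n `^ (s - r) * h n `^ r.
      by rewrite -powRD ?subrK// (gt_eqF (growth_gt0 h n)) implybT.
    rewrite ler_wpM2r ?powR_ge0// -(opprB r s) !powRN.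
    rewrite lef_pV2 ?posrE ?powR_gt0 ?growth_gt0//.
    rewrite ge0_ler_powR ?subr_ge0 ?nnegrE ?(ltW (growth_gt0 _ _))//.
    by case: (growth_funP h) => _ + _; apply.
  change (h n `^ s * x n * x n <= h 0 `^ (s - r) * (h n `^ r * x n * x n)).
  have {}hh := ler_wpM2r (sqr_ge0 (x n)) hh.
  by rewrite expr2 !mulrA in hh; rewrite !mulrA.
- exact: is_cvg_seriesZ.
Qed.

Definition hincl (x : Hsp h r) : Hsp h s := HSp (well2_sub (hseqP x)).

Fact hincl_is_linear : linear hincl.
Proof. by move=> a x y; apply/val_inj. Qed.

HB.instance Definition _ := GRing.isLinear.Build R (Hsp h r) (Hsp h s) _ hincl
  hincl_is_linear.

End Inclusion.

Arguments hincl {R} h {s r} sr x.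

Section Operators.
Context {R : realType}.
Implicit Types V W : normedModType R.

Definition bounded_op V W (T : V -> W) : Prop :=
  exists M : R, forall x, `|T x| <= M * `|x|.

(* The linear subspace P has a basis with n elements. *)
Definition has_dim V (P : set V) (n : nat) : Prop :=
  exists2 e : 'I_n -> V, (forall i, P (e i)) &
    forall x, P x -> exists! c : 'I_n -> R, x = \sum_(i < n) c i *: e i.

(* The quotient of V by the linear subspace P has a basis with n elements,     *)
(* namely the classes of the e i.                                              *)
Definition has_codim V (P : set V) (n : nat) : Prop :=
  exists e : 'I_n -> V,
    forall x, exists! c : 'I_n -> R, P (x - \sum_(i < n) c i *: e i).

Definition fredholm V W (T : {linear V -> W}) (k : int) : Prop :=
  closed (range T) /\
  exists p q : nat, [/\ has_dim [set x | T x = 0] p,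
    has_codim (range T) q & k = p%:Z - q%:Z].

Definition isomorphism V W (T : {linear V -> W}) : Prop :=
  bounded_op T /\
  exists S : {linear W -> V}, [/\ bounded_op S, cancel T S & cancel S T].

End Operators.

Section WeakHessians.
Context {R : realType} (h : growthFun R).

Local Notation H0 := (Hsp h 0).
Local Notation H1 := (Hsp h 1).
Local Notation H2 := (Hsp h 2).

Definition iota10 : {linear H1 -> H0} := hincl h ler01.
Definition iota21 : {linear H2 -> H1} := hincl h (ler1n R 2).

Definition shift_op (A : {linear H1 -> H0}) (lam : R) : {linear H1 -> H0} :=
  A \- lam \*: iota10.

Definition weak_hessian : set {linear H1 -> H0} :=
  [set A : {linear H1 -> H0} | [/\ bounded_op A,
    fredholm A 0,
    (forall x y : H1, inner (A x) (iota10 y) = inner (iota10 x) (A y))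
  & exists B : {linear H2 -> H1},
      [/\ forall x, iota10 (B x) = A (iota21 x), bounded_op B
        & fredholm B 0]]].

Definition spec (A : {linear H1 -> H0}) : set R :=
  [set lam | ~ isomorphism (shift_op A lam)].

Definition eigspace (A : {linear H1 -> H0}) (lam : R) : set H1 :=
  [set x | A x = lam *: iota10 x].

Definition eigenvalues (A : {linear H1 -> H0}) : set R :=
  [set lam | exists2 x, eigspace A lam x & x != 0].

Definition floer_type : set {linear H1 -> H0} :=
  [set A : {linear H1 -> H0} | [/\ weak_hessian A,
    infinite_set [set lam | eigenvalues A lam /\ 0 < lam]
  & infinite_set [set lam | eigenvalues A lam /\ lam < 0]]].

Definition invertible_floer_type : set {linear H1 -> H0} :=
  [set A : {linear H1 -> H0} | floer_type A /\ isomorphism A].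

(* f lists in increasing order the numbers mu > 0, each one repeated as many   *)
(* times as the dimension of E mu.                                             *)
Definition lists_in_order (E : R -> set H1) (f : nat -> R) : Prop :=
  [/\ forall n, 0 < f n,
      {homo f : m n / (m <= n)%N >-> m <= n}
    & forall mu, 0 < mu ->
        exists2 k : nat, has_dim (E mu) k & [set n | f n = mu] #= `I_k].

(* Such a list f is unique; when there is none, [get] returns the function 0,  *)
(* whose [growth_class] is empty and hence not a growth type.                  *)
Definition pos_growth (A : {linear H1 -> H0}) : nat -> R :=
  get (lists_in_order (eigspace A)).

Definition neg_growth (A : {linear H1 -> H0}) : nat -> R :=
  get (lists_in_order (fun mu => eigspace A (- mu))).

Definition invertible_floer_growth (a b : set (nat -> R)) :
    set {linear H1 -> H0} :=
  [set A : {linear H1 -> H0} | [/\ invertible_floer_type A,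
    growth_class (neg_growth A) = a & growth_class (pos_growth A) = b]].

End WeakHessians.

(* Main.v *)
Require Import Defs.
From HB Require Import structures.
From mathcomp Require Import all_boot all_order all_algebra.
From mathcomp Require Import all_classical all_reals all_analysis.
From mathcomp Require Import finmap lra zify.
Import Order.TTheory GRing.Theory Num.Theory.
Import numFieldNormedType.Exports.
Local Open Scope classical_set_scope.
Local Open Scope ring_scope.

(* Subtracting [lam] translates the spectrum, so the list of positive          *)
(* eigenvalues [f] of [A] becomes, up to dropping or adding finitely many terms *)
(* at the beginning, [f - lam].  An unbounded increasing [f] has the same       *)
(* growth as [f - lam] (once this is positive), and shift-invariance of the     *)
(* growth type of [f] makes the finite change of indices harmless.  The         *)
(* negative eigenvalues are the positive ones of [-A], with [-lam] for [lam].   *)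

(** Since [eigspace (shift_op A lam) mu] is [eigspace A (mu + lam)], the ordered lists of
    eigenvalues of the shifted operator can be written down explicitly from those of [A]. The lists
    of [A] exist and are unbounded because their classes are growth types; [lists_translate] builds
    the new lists and compares growth, and [lists_in_order_inj] identifies them with the values of
    [get] in [pos_growth] and [neg_growth]. Unbounded lists yield infinitely many eigenvalues of
    each sign, hence Floer type; [weak_hessian_shift] supplies the remaining analytic conditions. *)

Section SameGrowth.
Context {R : realType}.
Implicit Types f g k : nat -> R.

(** * Growth equivalence under shifts and translations *)

Lemma same_growth_refl f : same_growth f f.
Proof. by exists 1 => // n; rewrite invr1 !mul1r. Qed.

Lemma same_growth_sym f g : same_growth f g -> same_growth g f.
Proof.
move=> [c c0 fg]; exists c => // n; have [gf1 gf2] := fg n.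
by split; [rewrite ler_pdivrMl|rewrite -ler_pdivrMl].
Qed.

Lemma same_growth_trans f g k :
  same_growth f g -> same_growth g k -> same_growth f k.
Proof.
move=> [c c0 fg] [d d0 gk]; exists (c * d); first exact: mulr_gt0.
move=> n; have [fg1 fg2] := fg n; have [gk1 gk2] := gk n; split.
  rewrite invfM -mulrA (le_trans _ fg1)// ler_wpM2l// ?invr_ge0 ?ltW//.
by rewrite -mulrA (le_trans fg2)// ler_wpM2l// ltW.
Qed.

Lemma same_growth_class f g :
  same_growth f g -> growth_class f = growth_class g.
Proof.
move=> fg; apply/seteqP; split=> k [gk ?]; split=> //.
  exact: same_growth_trans (same_growth_sym _ _ fg) _.
exact: same_growth_trans fg _.
Qed.

Lemma same_growth_shift f m :
  same_growth f (shift_growth f) -> same_growth f (fun n => f (n + m)%N).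
Proof.
move=> ff; elim: m => [|m IHm].
  by rewrite (_ : (fun n => _) = f) ?funeqE => [|n]; rewrite ?addn0//;
    exact: same_growth_refl.
apply: same_growth_trans ff _; case: IHm => c c0 fm; exists c => // n.
by rewrite addnS -addSn; exact: fm.
Qed.

(** Finitely many positive initial terms only enlarge the constant: at each step the two ratios of
    the terms at 0 are added to [c]. *)
Lemma same_growth_unshift f g m : (forall n, 0 < f n) -> (forall n, 0 < g n) ->
  same_growth (fun n => f (n + m)%N) (fun n => g (n + m)%N) -> same_growth f g.
Proof.
elim: m f g => [|m IHm] f g f0 g0 [c c0 fg].
  by exists c => // n; have := fg n; rewrite addn0.
have : same_growth (shift_growth f) (shift_growth g).
  apply: IHm => [n|n|]; [exact: f0|exact: g0|exists c => // n].
  by have := fg n; rewrite /shift_growth addnS.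
move=> {fg c c0}[c c0 fg].
have fg0 : 0 < f 0%N / g 0%N by rewrite divr_gt0.
have gf0 : 0 < g 0%N / f 0%N by rewrite divr_gt0.
have d0 : 0 < c + f 0%N / g 0%N + g 0%N / f 0%N by rewrite !addr_gt0.
exists (c + f 0%N / g 0%N + g 0%N / f 0%N) => // -[|n].
  rewrite ler_pdivrMl//; split.
    rewrite !mulrDl divfK ?gt_eqF// lerDr -mulrDl mulr_ge0//.
      by rewrite addr_ge0// ltW.
    exact: ltW.
  rewrite !mulrDl divfK ?gt_eqF// addrAC lerDr -mulrDl.
  by rewrite mulr_ge0 ?addr_ge0 ?ltW.
have [fg1 fg2] := fg n; rewrite ler_pdivrMl//; rewrite ler_pdivrMl// in fg1.
split.
  rewrite (le_trans fg1)// ler_wpM2r ?(ltW (f0 _))//.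
  by rewrite -addrA lerDl addr_ge0// ltW.
rewrite (le_trans fg2)// ler_wpM2r ?(ltW (g0 _))//.
by rewrite -addrA lerDl addr_ge0// ltW.
Qed.

(** As [f n] is at least [f 0], [s] is at most [s / f 0 * f n], so the constant [1 + s / f 0]
    works. *)
Lemma same_growth_addr f s : (forall n, 0 < f n) ->
  {homo f : m n / (m <= n)%N >-> m <= n} -> 0 <= s ->
  same_growth f (fun n => f n + s).
Proof.
move=> f0 fnd s0; apply: same_growth_sym.
have d0 : 0 <= s / f 0%N by rewrite divr_ge0// ltW.
exists (1 + s / f 0%N) => [|n]; first by rewrite ltr_wpDr.
have fn := fnd 0%N n (leq0n n).
have sf : s <= s / f 0%N * f n.
  by rewrite mulrAC -mulrA ler_peMr// ler_pdivlMr// mul1r.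
rewrite ler_pdivrMl ?ltr_wpDr// !mulrDl !mul1r; split; last by rewrite lerD2l.
by rewrite -addrA lerDl !addr_ge0// mulr_ge0// addr_ge0// ltW.
Qed.

Lemma same_growth_subr f s : {homo f : m n / (m <= n)%N >-> m <= n} ->
  0 <= s -> s < f 0%N -> same_growth f (fun n => f n - s).
Proof.
move=> fnd s0 sf0.
(* This reduces to adding [s] to [f - s], which is positive because [s < f 0]. *)
have -> : f = (fun n => (f n - s) + s) by apply/funext => n; rewrite subrK.
rewrite (_ : (fun n => _ - s) = fun n => f n - s); last first.
  by apply/funext => n; rewrite subrK.
apply/same_growth_sym/same_growth_addr => // [n|m n mn].
  by rewrite subr_gt0 (lt_le_trans sf0)// fnd.
by rewrite lerD2r fnd.
Qed.

Lemma same_growth_unbounded f g : (forall M, exists n, M < f n) ->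
  same_growth f g -> forall M, exists n, M < g n.
Proof.
move=> fu [c c0 fg] M; have [n Mn] := fu (c * M); exists n.
by rewrite -(ltr_pM2l c0) (lt_le_trans Mn)//; have [] := fg n.
Qed.

Lemma unbounded_threshold f s : (forall M, exists n, M < f n) ->
  {homo f : m n / (m <= n)%N >-> m <= n} ->
  exists m, forall n, (s < f n) = (m <= n)%N.
Proof.
move=> fu fnd; case: (ex_minnP (fu s)) => m sm mmin; exists m => n.
apply/idP/idP => [/mmin//|mn]; exact: lt_le_trans sm (fnd _ _ mn).
Qed.

(** A nondecreasing list is determined by the finite multiplicities of its values; this gives
    uniqueness of eigenvalue lists. *)
Lemma nondecreasing_eq_fibers f g :
  {homo f : m n / (m <= n)%N >-> m <= n} ->
  {homo g : m n / (m <= n)%N >-> m <= n} ->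
  (forall n, finite_set [set i | f i = f n]) ->
  (forall n, finite_set [set i | g i = g n]) ->
  (forall n, ([set i | f i = f n] #= [set i | g i = f n])%card) ->
  (forall n, ([set i | f i = g n] #= [set i | g i = g n])%card) ->
  f = g.
Proof.
(* If [f1 n < f2 n] while the lists agree before [n], then [f2] takes the value [f1 n] only before
   [n]. Its fiber thus lies in that of [f1] but misses [n], against equal finite cardinality. *)
have least f1 f2 n : {homo f2 : m n / (m <= n)%N >-> m <= n} ->
    finite_set [set i | f1 i = f1 n] ->
    ([set i | f1 i = f1 n] #= [set i | f2 i = f1 n])%card ->
    (forall m, (m < n)%N -> f1 m = f2 m) -> f2 n <= f1 n.
  move=> f2nd fin fE lt; rewrite leNgt; apply/negP => f12.
  have sub : [set i | f2 i = f1 n] `<=` [set i | f1 i = f1 n].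
    move=> i /= f2i; rewrite -f2i; apply: lt; rewrite ltnNge; apply/negP => ni.
    by have := f2nd _ _ ni; rewrite f2i leNgt f12.
  have fin2 := sub_finite_set sub fin.
  have := sub; rewrite fset_set_sub// => /fsubset_leqif_cards[_].
  move/(fcard_eq fin fin2) : fE => ->; rewrite eqxx => /esym/eqP/fset_set_inj.
  move=> /(_ fin2 fin) E; have : [set i | f1 i = f1 n] n by [].
  by rewrite -E /= => f2n; rewrite f2n ltxx in f12.
move=> fnd gnd ffin gfin fE gE; apply/funext => n.
elim/ltn_ind: n => n IHn; apply/le_anti/andP; split.
  apply: least => // [|m mn]; last by rewrite IHn.
  by rewrite card_eq_sym.
exact: least.
Qed.

End SameGrowth.

(** * Invariance of dimension, and Fredholm maps of index zero *)

Section Dimension.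
Context {R : realType}.
Implicit Types V W : normedModType R.

Lemma has_dim_inj V (P : set V) m n : has_dim P m -> has_dim P n -> m = n.
Proof.
have dim_le k l : has_dim P k -> has_dim P l -> (k <= l)%N.
  move=> [e Pe he] [e' Pe' he'].
  have /choice[M eM] i : exists c : 'I_l -> R, e i = \sum_j c j *: e' j.
    by have [c [ec _]] := he' _ (Pe i); exists c.
  have /choice[N eN] i : exists c : 'I_k -> R, e' i = \sum_j c j *: e j.
    by have [c [ec _]] := he _ (Pe' i); exists c.
  (* The two change-of-basis matrices have product 1, by uniqueness of the coordinates of [e i]. *)
  apply: (@mulmx1_min R k l (\matrix_(i, j) M i j) (\matrix_(j, i) N j i)).
  apply/matrixP => i j; rewrite !mxE.
  have [c [_ cU]] := he _ (Pe i).
  rewrite (eq_bigr (fun t => M i t * N t j)); last by move=> t _; rewrite !mxE.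
  have c1 : c = (fun j => (i == j)%:R).
    apply: cU; rewrite (bigD1 i)//= eqxx scale1r big1 ?addr0// => t ti.
    by rewrite eq_sym (negbTE ti) scale0r.
  have c2 : c = (fun j => \sum_t M i t * N t j).
    apply: cU; rewrite [LHS]eM; under [RHS]eq_bigr do rewrite scaler_suml.
    rewrite exchange_big/=; apply: eq_bigr => t _.
    rewrite [in LHS]eN scaler_sumr.
    by apply: eq_bigr => u _; rewrite scalerA.
  by have := congr1 (@^~ j) c2; rewrite c1 => /= <-.
by move=> Pm Pn; apply/eqP; rewrite eqn_leq !dim_le.
Qed.

Lemma has_dim_zero V : has_dim [set (0 : V)] 0.
Proof.
exists (fun=> 0) => // x /= ->; exists (fun=> 0); split.
  by rewrite big_ord0.
by move=> c _; apply/funext => -[].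
Qed.

Lemma has_codim0_setT V (P : set V) : has_codim P 0 -> P = setT.
Proof.
move=> [e he]; apply/seteqP; split=> // x _.
by have [c [+ _]] := he x; rewrite big_ord0 subr0.
Qed.

Lemma has_codim_setT V : has_codim [set: V] 0.
Proof.
exists (fun=> 0) => x; exists (fun=> 0); split=> // c _.
by apply/funext => -[].
Qed.

Lemma bijective_fredholm V W (T : {linear V -> W}) :
  injective T -> (forall y, exists x, T x = y) -> fredholm T 0.
Proof.
move=> Ti Ts; have rT : range T = setT.
  by apply/seteqP; split=> // y _; have [x <-] := Ts y; exists x.
split; first by rewrite rT; exact: closedT.
exists 0%N, 0%N; split=> //; last by rewrite rT; exact: has_codim_setT.
rewrite (_ : [set x | _] = [set 0]); first exact: has_dim_zero.
apply/seteqP; split=> [x /= Tx|_ ->/=]; last by rewrite linear0.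
by apply: Ti; rewrite Tx linear0.
Qed.

Lemma injective_fredholm_surj V W (T : {linear V -> W}) :
  injective T -> fredholm T 0 -> forall y, exists x, T x = y.
Proof.
move=> Ti [_ [p [q [dp dq /eqP]]]]; rewrite eq_sym subr_eq0 eqz_nat => /eqP pq.
have {dp} : has_dim [set x | T x = 0] 0 -> p = 0%N by exact: has_dim_inj.
rewrite (_ : [set x | _] = [set 0]); last first.
  apply/seteqP; split=> [x /= Tx|_ ->/=]; last by rewrite linear0.
  by apply: Ti; rewrite Tx linear0.
move=> /(_ (has_dim_zero V)) p0; move: dq; rewrite -pq p0 => /has_codim0_setT E y.
by have [] : range T y; [rewrite E|move=> x _ <-; exists x].
Qed.

End Dimension.

(** * Ordered eigenvalue lists and their translation *)

Section Lists.
Context {R : realType} (h : growthFun R).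
Implicit Types (E : R -> set (Hsp h 1)) (f g : nat -> R).

Lemma lists_in_order_inj E f g :
  lists_in_order E f -> lists_in_order E g -> f = g.
Proof.
move=> [f0 fnd fE] [g0 gnd gE]; apply: nondecreasing_eq_fibers => // n.
- have [k _ kE] := fE _ (f0 n); by apply/finite_setP; exists k.
- have [k _ kE] := gE _ (g0 n); by apply/finite_setP; exists k.
- have [k dk kE] := fE _ (f0 n); have [l dl lE] := gE _ (f0 n).
  rewrite (has_dim_inj _ _ _ _ dk dl) in kE.
  exact: card_eq_trans kE (card_esym lE).
- have [k dk kE] := fE _ (g0 n); have [l dl lE] := gE _ (g0 n).
  rewrite (has_dim_inj _ _ _ _ dk dl) in kE.
  exact: card_eq_trans kE (card_esym lE).
Qed.

(** Translating to the left discards the terms that are at most [s]; [m] is the index of the first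
    surviving one. *)
Lemma lists_subr E f s : 0 <= s -> lists_in_order E f ->
  (forall M, exists n, M < f n) ->
  exists2 m, s < f m &
    lists_in_order (fun mu => E (mu + s)) (fun n => f (n + m)%N - s).
Proof.
move=> s0 [f0 fnd fE] fu.
have [m fm] := unbounded_threshold _ s fu fnd; exists m; first by rewrite fm.
split=> [n|i j ij|mu mu0]; first by rewrite subr_gt0 fm leq_addl.
  by rewrite lerD2r fnd// leq_add2r.
have [k dk kE] := fE (mu + s) (ltr_wpDr s0 mu0).
exists k => //; apply: card_eq_trans kE.
have -> : [set n | f n = mu + s] =
    (addn^~ m) @` [set n | f (n + m)%N - s = mu].
  apply/seteqP; split=> [n /= fn|_ [n /= fn <-]/=].
    have mn : (m <= n)%N by rewrite -fm fn ltrDr.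
    by exists (n - m)%N; rewrite /= subnK// fn addrK.
  by rewrite -fn subrK.
by rewrite card_eq_sym; apply: inj_card_eq => i j _ _; exact: addIn.
Qed.

(* Translating by [s] to the right makes the finitely many negative            *)
(* eigenvalues in the interval ]-s, 0[ positive, in reversed order of their    *)
(* absolute values.                                                            *)
Lemma lists_addr E fp fm s : 0 <= s ->
  lists_in_order E fp -> lists_in_order (fun mu => E (- mu)) fm ->
  has_dim (E 0) 0 -> (forall M, exists n, M < fm n) ->
  exists m g, lists_in_order (fun mu => E (mu - s)) g /\
    forall n, g (n + m)%N = fp n + s.
Proof.
move=> s0 [fp0 fpnd fpE] [fm0 fmnd fmE] E0 fmu.
have [m fmP] : exists m, forall n, (fm n < s) = (n < m)%N.
  have ex : exists n, s <= fm n by have [n /ltW] := fmu s; exists n.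
  case: (ex_minnP ex) => m sm mmin; exists m => n.
  rewrite ltNge ltnNge; congr (~~ _); apply/idP/idP => [/mmin//|mn].
  exact: le_trans sm (fmnd _ _ mn).
(* The first [m] terms come from the eigenvalues [- fm k] in the interval ]-s, 0[, the largest
   [fm k] first. *)
pose g n := if (n < m)%N then s - fm (m - n.+1)%N else fp (n - m)%N + s.
exists m, g; split; last by move=> n; rewrite /g ltnNge leq_addl /= addnK.
have gfm n : (n < m)%N -> fm (m - n.+1)%N < s by rewrite fmP; lia.
split=> [n|i j ij|mu mu0].
- rewrite /g; case: ifPn => [/gfm|_]; first by rewrite subr_gt0.
  by rewrite ltr_wpDr.
- rewrite /g; case: ifPn => im; case: ifPn => jm.
  + by rewrite lerD2l lerN2 fmnd//; lia.
  + by rewrite addrC lerD2r (le_trans _ (ltW (fp0 _)))// oppr_le0 ltW.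
  + by lia.
  + by rewrite lerD2r fpnd//; lia.
(* The value [mu] comes from the eigenvalue [mu - s]: below [s] it is a negative one, above [s] a
   positive one, and at [s] the trivial space [E 0] gives multiplicity zero. *)
have [mus|smu|mus] := ltgtP mu s.
- have [k dk kE] := fmE (s - mu) ltac:(by rewrite subr_gt0).
  exists k; first by rewrite -(opprB s).
  apply: card_eq_trans kE.
  have -> : [set n | fm n = s - mu] =
      (fun n => m - n.+1)%N @` [set n | g n = mu].
    apply/seteqP; split=> [n /= fmn|_ [n /= gn <-]/=].
      have nm : (n < m)%N by rewrite -fmP fmn ltrBlDr ltrDl.
      exists (m - n.+1)%N; last by lia.
      rewrite /g (_ : (m - n.+1 < m)%N); last by lia.
      by rewrite (_ : m - (m - n.+1).+1 = n)%N ?fmn ?subKr//; lia.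
    move: gn; rewrite /g; case: ifPn => [nm <-|_ gn]; first by rewrite subKr.
    by move: mus; rewrite -gn; have := fp0 (n - m)%N; lra.
  rewrite card_eq_sym; apply: inj_card_eq => i j; rewrite !in_setE/= => gi gj.
  have ltm n : g n = mu -> (n < m)%N.
    move=> gn; case: ltnP => // mn; move: gn mus; rewrite /g ltnNge mn/=.
    by have := fp0 (n - m)%N; lra.
  by move: (ltm _ gi) (ltm _ gj); lia.
- have [k dk kE] := fpE (mu - s) ltac:(by rewrite subr_gt0).
  exists k => //; apply: card_eq_trans kE.
  have -> : [set n | g n = mu] = (addn^~ m) @` [set n | fp n = mu - s].
    apply/seteqP; split=> [n /=|_ [n /= fn <-]/=].
      rewrite /g; case: ifPn => [nm gn|].
        by have := fm0 (m - n.+1)%N; lra.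
      rewrite -leqNgt => mn <-; exists (n - m)%N; last by rewrite subnK.
      by rewrite /= addrK.
    by rewrite /g ltnNge leq_addl/= addnK fn subrK.
  by apply: inj_card_eq => i j _ _; exact: addIn.
- exists 0%N; first by rewrite mus subrr.
  rewrite II0 card_eq0; apply/eqP; rewrite -subset0 => n /=.
  rewrite mus /g; case: ifPn => _.
    by have := fm0 (m - n.+1)%N; lra.
  by have := fp0 (n - m)%N; lra.
Qed.

(** A left translation drops initial terms and a right one prepends some; either way
    shift-invariance of [fp] absorbs the change of index. *)
Lemma lists_translate E fp fm s :
  lists_in_order E fp -> lists_in_order (fun mu => E (- mu)) fm ->
  has_dim (E 0) 0 ->
  (forall M, exists n, M < fp n) -> (forall M, exists n, M < fm n) ->
  same_growth fp (shift_growth fp) ->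
  exists2 g, lists_in_order (fun mu => E (mu + s)) g & same_growth fp g.
Proof.
move=> lp lm E0 fpu fmu fps; have [fp0 fpnd _] := lp.
have [s0|s0] := leP 0 s.
  have [m sm lg] := lists_subr _ _ _ s0 lp fpu.
  exists (fun n => fp (n + m)%N - s) => //.
  apply: same_growth_trans (same_growth_shift _ m fps) _.
  apply: (same_growth_subr (fun n => fp (n + m)%N)) => // i j ij.
  by rewrite fpnd// leq_add2r.
have [|m [g [lg gE]]] := lists_addr _ _ _ (- s) _ lp lm E0 fmu.
  by rewrite oppr_ge0 ltW.
exists g; first by rewrite opprK in lg.
have [g0 _ _] := lg.
(* Only tails matter: [g (n + m)] is [fp n - s], which grows like [fp n], hence like
   [fp (n + m)]. *)
apply: (same_growth_unshift _ _ m) => //.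
apply: same_growth_trans (same_growth_sym _ _ (same_growth_shift _ m fps)) _.
rewrite (_ : (fun n => g _) = fun n => fp n - s); last exact/funext.
by apply: same_growth_addr => //; rewrite oppr_ge0 ltW.
Qed.

(** The fiber of [f n] contains [n], so the dimension is positive, and uniqueness of coordinates
    makes a basis vector nonzero. *)
Lemma lists_eigenspace_neq0 E f n : lists_in_order E f ->
  exists2 x, E (f n) x & x != 0.
Proof.
move=> [f0 _ fE]; have [k [e Ee he] kE] := fE _ (f0 n).
have k0 : (0 < k)%N.
  rewrite lt0n; apply/eqP => k0; move: kE; rewrite k0 II0 card_eq0 => /eqP kE.
  by have : [set i | f i = f n] n by []; rewrite kE.
exists (e (Ordinal k0)); first exact: Ee.
apply/eqP => e0; have [c [_ cU]] := he _ (Ee (Ordinal k0)).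
have c0 : c = (fun=> 0).
  by apply: cU; rewrite big1// => i _; rewrite scale0r.
have : c = (fun i => (i == Ordinal k0)%:R).
  apply: cU; rewrite (bigD1 (Ordinal k0))//= scale1r big1 ?addr0// => i.
  by move=> /negbTE ->; rewrite scale0r.
rewrite c0 => /(congr1 (@^~ (Ordinal k0))) /=; rewrite ?eqxx => /eqP.
by rewrite eq_sym oner_eq0.
Qed.

End Lists.

Lemma unbounded_infinite_range {R : realType} (f : nat -> R) :
  (forall M, exists n, M < f n) -> infinite_set (range f).
Proof.
move=> fu /finite_seqP[s fs].
have [n] := fu (\big[Num.max/0]_(x <- s) x); rewrite ltNge => /negP; apply.
apply: (le_bigmax_seq _ (f n) xpredT id) => //.
by suff: [set` s] (f n) by []; rewrite -fs; exists n.
Qed.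

(** * Translated operators are weak Hessians *)

Section Translate.
Context {R : realType} (h : growthFun R).
Implicit Type A : {linear Hsp h 1 -> Hsp h 0}.

Lemma bounded_hincl (s r : R) (sr : s <= r) : bounded_op (hincl h sr).
Proof.
exists (Num.sqrt (h 0%N `^ (s - r))) => x.
have normE t (y : Hsp h t) : `|y| = Num.sqrt (inner y y) by [].
rewrite !normE -sqrtrM ?powR_ge0//; apply: ler_wsqrtr.
have cvx := @is_cvg_inner _ _ _ x x.
apply: (@le_trans _ _ (limn (series (h 0%N `^ (s - r) *: wprod h r x x))));
  last first.
  by rewrite lim_seriesZ.
apply: lim_series_le; [exact: is_cvg_inner|exact: is_cvg_seriesZ|move=> n].
change (h n `^ s * x n * x n <= h 0%N `^ (s - r) * (h n `^ r * x n * x n)).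
rewrite -!(mulrA _ (x n)) -expr2 mulrA ler_wpM2r ?sqr_ge0//.
have -> : h n `^ s = h n `^ (s - r) * h n `^ r.
  by rewrite -powRD ?subrK// (gt_eqF (growth_gt0 h n)) implybT.
rewrite ler_wpM2r ?powR_ge0// -(opprB r s) !powRN.
rewrite lef_pV2 ?posrE ?powR_gt0 ?growth_gt0//.
rewrite ge0_ler_powR ?subr_ge0 ?nnegrE ?(ltW (growth_gt0 _ _))//.
by case: (growth_funP h) => _ + _; apply.
Qed.

Lemma hincl_inj (s r : R) (sr : s <= r) : injective (hincl h sr).
Proof. by move=> x y /(congr1 (@hseq _ _ _)) xy; exact/val_inj. Qed.

Lemma eigspace_shift A lam :
  eigspace (shift_op A lam) = fun mu => eigspace A (mu + lam).
Proof.
apply/funext => mu; apply/seteqP; split=> x; rewrite /eigspace/= /shift_op/=.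
  by move=> /eqP; rewrite subr_eq scalerDl => /eqP.
by move=> ->; rewrite scalerDl addrK.
Qed.

Lemma isomorphism_fredholm (V W : normedModType R) (T : {linear V -> W}) :
  isomorphism T -> fredholm T 0.
Proof.
move=> [_ [S [_ TS ST]]]; apply: bijective_fredholm; first exact: can_inj TS.
by move=> y; exists (S y).
Qed.

(* If [(A - lam) x = y] with [y] in [H_1], then [A x] lies in [H_1], hence     *)
(* [x] lies in [H_2]: so [A - lam : H_2 -> H_1] is onto, without appealing to  *)
(* the compactness of the inclusion.                                           *)
Lemma weak_hessian_shift A lam : weak_hessian A -> isomorphism A ->
  isomorphism (shift_op A lam) -> weak_hessian (shift_op A lam).
Proof.
move=> [_ _ Asym [B [BE [M BM] BF]]] [_ [S [_ AS SA]]] Liso.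
have [Lb [L [_ LK KL]]] := Liso.
have Ai := can_inj AS; have Li := can_inj LK.
have shiftE x : shift_op A lam x = (- lam) *: iota10 h x + A x.
  rewrite scaleNr [RHS]addrC; reflexivity.
split; [exact: Lb|exact: isomorphism_fredholm| |].
  move=> x y; rewrite !shiftE innerDl [RHS]innerC innerDl Asym.
  by rewrite (innerC (A y)) (innerC (iota10 h y)).
(* [B] inherits injectivity from [A], and index zero then makes it onto. *)
have Bi : injective B.
  move=> x y Bxy; apply: (hincl_inj _ _ (ler1n R 2)); apply: Ai.
  exact: etrans (esym (BE x)) (etrans (congr1 (iota10 h) Bxy) (BE y)).
have Bs := injective_fredholm_surj _ _ _ Bi BF.
pose B' : {linear Hsp h 2 -> Hsp h 1} := B \- lam \*: iota21 h.
have B'E x : iota10 h (B' x) = shift_op A lam (iota21 h x).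
  rewrite shiftE -BE -[RHS]linearP; congr (iota10 h _).
  rewrite scaleNr [RHS]addrC; reflexivity.
exists B'; split; [exact: B'E| |].
  have [C CM] := bounded_hincl _ _ (ler1n R 2).
  exists (M + `|lam| * C) => x; rewrite /B'/= (le_trans (ler_normB _ _))//.
  by rewrite mulrDl lerD// normrZ -mulrA ler_wpM2l// CM.
apply: bijective_fredholm => [x y xy|y].
  apply: (hincl_inj _ _ (ler1n R 2)); apply: Li.
  exact: etrans (esym (B'E x)) (etrans (congr1 (iota10 h) xy) (B'E y)).
(* The solution [x] of [(A - lam) x = y] satisfies [A x = lam x + y], so its lift to H_2 is the
   preimage of that vector under [B]. *)
have [z Bz] := Bs (lam *: L (iota10 h y) + y).
have zL : iota21 h z = L (iota10 h y).
  apply: Ai; rewrite -BE Bz linearP.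
  move: (L (iota10 h y)) (KL (iota10 h y)) => u; rewrite shiftE => <-.
  rewrite scaleNr; exact: addNKr.
exists z; apply: (hincl_inj _ _ ler01).
exact: etrans (B'E z) (etrans (congr1 (shift_op A lam) zL) (KL _)).
Qed.

End Translate.

(** * Assembly: both eigenvalue lists of the shifted operator *)

Theorem proposition1p5 (R : realType) (h : growthFun R)
    (a b : set (nat -> R))
    (ha : shift_invariant_growth_types a)
    (hb : shift_invariant_growth_types b)
    (A : {linear Hsp h 1 -> Hsp h 0})
    (hA : invertible_floer_growth a b A)
    (lam : R) (hlam : ~ spec A lam) :
  invertible_floer_growth a b (shift_op A lam).
Proof.
have Liso : isomorphism (shift_op A lam) by exact: contrapT.
have [[[Aw _ _] Aiso] nga pgb] := hA.
(* A representative [f] of the class [c] transfers unboundedness and shift-invariance to the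
   list. *)
have listP E c : shift_invariant_growth_types c ->
    growth_class (get (@lists_in_order R h E)) = c ->
  [/\ lists_in_order E (get (lists_in_order E)),
    forall M, exists n, M < get (lists_in_order E) n
    & same_growth (get (lists_in_order E))
        (shift_growth (get (lists_in_order E)))].
  move=> [f [fg ff] <-]; set g := get _ => gf.
  have [_ sgf] : growth_class g f.
    by rewrite gf; split=> //; exact: same_growth_refl.
  have [f0 fnd fu] := fg.
  have lg : lists_in_order E g.
    (* Without a list, [get] would return the zero function, which cannot dominate a multiple of the
       positive [f]. *)
    rewrite /g /get; case: xgetP => [k _ //|nE]; exfalso.
    have g0 : g = point by apply: getPN => k; exact: nE.
    have [d d0 /(_ 0%N)[+ _]] := sgf.
    rewrite g0 leNgt => /negP; apply.
    by rewrite mulr_gt0 ?invr_gt0.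
  split=> //.
    exact: same_growth_unbounded fu (same_growth_sym _ _ sgf).
  have [d d0 fg'] := same_growth_sym _ _ sgf.
  apply: same_growth_trans sgf (same_growth_trans _ _ _ ff _).
  by exists d => // n; exact: fg'.
have [lp pu ps] := listP _ _ hb pgb.
have [lm mu ms] := listP _ _ ha nga.
have E0 : has_dim (eigspace A 0) 0.
  have [_ [S [_ AS _]]] := Aiso.
  rewrite (_ : eigspace A 0 = [set 0]); first exact: has_dim_zero.
  apply/seteqP; split=> [x|_ ->]; rewrite /eigspace/=; last first.
    by rewrite linear0 scale0r.
  rewrite scale0r => Ax.
  exact: etrans (esym (AS x)) (etrans (congr1 S Ax) (linear0 S)).
have [gp lgp sgp] := lists_translate h _ _ _ lam lp lm E0 pu mu ps.
(* Reflecting the spectrum exchanges the two lists and turns the translation [lam] into [- lam]. *)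
have [] := lists_translate h (fun mu => eigspace A (- mu)) _ _
  (- lam) lm _ _ mu pu ms.
  by rewrite (_ : (fun _ => _) = eigspace A)//; apply/funext => t; rewrite opprK.
  by rewrite oppr0.
move=> gm lgm sgm.
have {lgp} lgp : lists_in_order (eigspace (shift_op A lam)) gp.
  by rewrite eigspace_shift.
have {lgm} lgm : lists_in_order (fun mu => eigspace (shift_op A lam) (- mu)) gm.
  rewrite eigspace_shift.
  rewrite (_ : (fun _ => _) = fun t => eigspace A (- (t + - lam)))//.
  by apply/funext => t; rewrite opprD opprK.
have getE E g : @lists_in_order R h E g -> get (lists_in_order E) = g.
  move=> lg; apply: (@lists_in_order_inj R h E) => //.
  by apply: getPex; exists g.
split.
- split=> //; split; first exact: weak_hessian_shift.
  + apply: sub_infinite_set (unbounded_infinite_range gp _); last first.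
      exact: same_growth_unbounded pu sgp.
    move=> _ [n _ <-]; split; first exact: lists_eigenspace_neq0.
    by have [+ _ _] := lgp; apply.
  + apply: (@sub_infinite_set _ (range (fun n => - gm n))).
      move=> _ [n _ <-]; split; first exact: lists_eigenspace_neq0 lgm.
      by rewrite oppr_lt0; have [+ _ _] := lgm; apply.
    move=> fin; apply: (unbounded_infinite_range gm).
      exact: same_growth_unbounded mu sgm.
    rewrite (_ : range gm = -%R @` range (fun n => - gm n)).
      exact: finite_image.
    apply/seteqP; split=> [_ [n _ <-]|_ [_ [n _ <-] <-]]/=.
      by exists (- gm n); rewrite ?opprK//; exists n.
    by exists n; rewrite ?opprK.
- rewrite /neg_growth (getE _ _ lgm) -nga; exact/esym/same_growth_class.
- rewrite /pos_growth (getE _ _ lgp) -pgb; exact/esym/same_growth_class.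
Qed.
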